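(* Let $f:A\to B$ be a ring homomorphism and let $J$ be an ideal of $B$ with $B=f(A)+J$. Suppose that $A$ is a local ring with finitely generated maximal ideal $M$, and that $J$ is a finitely generated ideal of $B$. If $f(M)B\subseteq\mathrm{Jac}(B)$ and $J\subseteq\mathrm{Jac}(B)$, then $A\bowtie^f J$ is a local ring with finitely generated maximal ideal, and $$\mathrm{embdim}(A\bowtie^f J)=\mathrm{embdim}(A)+\nu(J).$$
   Context: All rings are commutative with unity; ''local'' means having exactly one maximal ideal. $A\bowtie^f J:=\{(a,f(a)+j)\mid a\in A,\ j\in J\}$ is a subring of $A\times B$. $\mathrm{Jac}(B)$ is the Jacobson radical of $B$ and $f(M)B$ the ideal of $B$ generated by $f(M)$. For a finitely generated ideal $I$, $\nu(I)$ is the minimum number of generators of $I$. For a local ring $R$ with finitely generated maximal ideal $N$, $\mathrm{embdim}(R):=\nu(N)=\dim_{R/N}(N/N^2)$. *)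

(* Defs.v *)
From HB Require Import structures.
From mathcomp Require Import all_boot all_order all_algebra.
From mathcomp Require Import all_classical.

Set Implicit Arguments.
Unset Strict Implicit.
Unset Printing Implicit Defensive.

Import GRing.Theory.
Local Open Scope classical_set_scope.
Local Open Scope ring_scope.

(* Rings are [comPzRingType]: commutative and unital, with the zero ring
   allowed.  Ideals are [Prop]-valued sets, and the unit ideal is an ideal;
   both points differ from [idealr] of [ring_quotient], which is decidable,
   proper and only defined over nonzero rings. *)

Section Ideals.
Variable R : comPzRingType.
Implicit Types I N : set R.

Definition is_ideal I : Prop :=
  [/\ I 0, (forall x y, I x -> I y -> I (x + y))
    & (forall r x, I x -> I (r * x))].

Record ideal := Ideal { ideal_set :> set R; idealP : is_ideal ideal_set }.

Definition ideal_gen (S : set R) : set R := smallest is_ideal S.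

Definition maximal_ideal N : Prop :=
  [/\ is_ideal N, N <> setT
    & forall I, is_ideal I -> N `<=` I -> I <> setT -> I = N].

Definition jacobson : set R := \bigcap_(N in maximal_ideal) N.

Definition local_ring : Prop := exists! N, maximal_ideal N.

Definition generated_by_n I (n : nat) : Prop :=
  exists s : n.-tuple R, I = ideal_gen [set` s].

Definition fin_gen I : Prop := exists n, generated_by_n I n.

(* The value is 0 when [I] is not finitely generated. *)
Definition nu I : nat :=
  xget 0%N [set n | generated_by_n I n /\
                    forall m, generated_by_n I m -> (n <= m)%N].

(* When [R] is local, the maximal ideal of [R]. *)
Definition max_ideal : set R := xget set0 maximal_ideal.

Definition embdim : nat := nu max_ideal.

End Ideals.

Arguments jacobson : clear implicits.
Arguments local_ring : clear implicits.
Arguments max_ideal : clear implicits.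
Arguments embdim : clear implicits.

Section Characterizations.
Variable R : comPzRingType.

Lemma nuP (I : set R) : fin_gen I ->
  generated_by_n I (nu I) /\ forall m, generated_by_n I m -> (nu I <= m)%N.
Proof.
move=> [k Ik]; rewrite /nu; case: xgetP => [n _ //|] /= Hno; exfalso.
have ex : exists n, `[< generated_by_n I n >] by exists k; apply/asboolP.
case: (ex_minnP ex) => n /asboolP In nmin.
by apply: (Hno n); split=> // m Im; apply: nmin; apply/asboolP.
Qed.

Lemma local_max_idealP (N : set R) :
  local_ring R -> maximal_ideal N -> max_ideal R = N.
Proof.
move=> [K [Kmax Kuniq]] Nmax; apply: xget_unique => // N' N'max.
by rewrite -(Kuniq _ Nmax) -(Kuniq _ N'max).
Qed.

End Characterizations.

Section Amalgamation.
Variables (A B : comPzRingType) (f : {rmorphism A -> B}) (J : ideal B).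

Definition amalg_set : set (A * B) :=
  [set (a, f a + j) | a in [set: A] & j in J].

Lemma amalg_subring : subring_closed (fun x => x \in amalg_set).
Proof.
have [J0 JD JM] := idealP J.
have JN j : (J : set B) j -> (J : set B) (- j) by move=> Jj; rewrite -mulN1r; exact: JM.
split=> [|x y|x y]; rewrite -!topredE /= !in_setE.
- by exists 1 => //; exists 0 => //; rewrite rmorph1 addr0.
- move=> [a _ [j Jj <-]] [b _ [k Jk <-]]; exists (a - b) => //.
  exists (j - k); first exact: JD (JN _ Jk).
  by congr pair; rewrite rmorphB /= opprD addrACA.
- move=> [a _ [j Jj <-]] [b _ [k Jk <-]]; exists (a * b) => //.
  exists (f a * k + (f b * j + k * j)).
    by apply: (JD); [exact: JM|apply: (JD); exact: JM].
  congr pair; rewrite rmorphM mulrDr !mulrDl -!addrA; congr (_ + _).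
  by rewrite addrCA; congr (_ + (_ + _)); rewrite mulrC.
Qed.

Definition amalg : Type := {x : A * B | x \in amalg_set}.

HB.instance Definition _ := SubChoice.on amalg.
HB.instance Definition _ :=
  GRing.SubChoice_isSubComPzRing.Build (A * B)%type
    (fun x => x \in amalg_set) amalg amalg_subring.

End Amalgamation.

(* Main.v *)
Require Import Defs.
From HB Require Import structures.
From mathcomp Require Import all_boot all_order all_algebra.
From mathcomp Require Import all_classical.

Set Implicit Arguments.
Unset Strict Implicit.
Unset Printing Implicit Defensive.

Import GRing.Theory.
Local Open Scope classical_set_scope.
Local Open Scope ring_scope.

(** Write R for the amalgamation, p : R -> A and q : R -> B for its two
    projections, and N for the set of all r with p r in M.

    R is local with maximal ideal N because r is a unit as soon as p r is: then
    q r differs from the unit f (p r) by an element of J, which lies in the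
    Jacobson radical, so q r is a unit too, and the inverse of the pair stays
    in R ([amalg_unit], [amalg_local]).

    For the embedding dimension, 0 x J is the kernel of N -> M, and since
    B = f(A) + J the projection q is onto, so R-linear generation inside 0 x J
    is B-linear generation inside J.  Lifts of generators of M together with
    the pairs (0, j), for j in a generating family of J, therefore generate N
    ([amalg_max_generated]).

    Conversely, let z_1, ..., z_n generate N ([amalg_generators_lower_bound]).
    Their first projections x_i generate M; keep a minimal set S of indices
    such that the x_k with k in S still generate M, so that |S| >= nu M.  For i
    outside S, subtracting a combination of the z_k with k in S turns z_i into
    some (0, w_i) with w_i in J.  It remains to see that these n - |S| elements
    generate J.  If (0, j) is written on the modified generators, the
    coefficients of the z_k with k in S form a syzygy of the x_k after applying
    p, so by minimality they lie in N ([minimal_generators_syzygy]).  Expanding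
    then shows that j belongs to the span of the w_i plus Jac(B) J, and
    Nakayama's lemma ([nakayama]) concludes.  Minimality of S for inclusion is
    enough, so no vector space dimension is ever computed. *)

(** * Ideals and generators *)

Section Ideals.
Variable R : comPzRingType.
Implicit Types (I J K N : set R) (a c x y : R).

Lemma is_idealN I x : is_ideal I -> I x -> I (- x).
Proof. by case=> _ _ IM Ix; rewrite -mulN1r; apply: IM. Qed.

Lemma is_ideal_sum (T : Type) (s : seq T) (P : pred T) (F : T -> R) I :
  is_ideal I -> (forall i, P i -> I (F i)) -> I (\sum_(i <- s | P i) F i).
Proof. by case=> I0 ID _ IF; elim/big_ind: _. Qed.

Lemma is_idealT : is_ideal [set: R]. Proof. by split. Qed.

Lemma ideal_eqT I : is_ideal I -> I 1 -> I = setT.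
Proof.
case=> _ _ IM I1; apply/seteqP; split=> // x _.
by rewrite -(mulr1 x); apply: IM.
Qed.

Lemma is_ideal_bigcap (F : set (set R)) :
  F `<=` @is_ideal R -> is_ideal (\bigcap_(I in F) I).
Proof.
move=> Fid; split=> [I /Fid[] //|x y Ix Iy I FI|r x Ix I FI].
- by case: (Fid _ FI) => _ ID _; apply: ID; [exact: Ix|exact: Iy].
- by case: (Fid _ FI) => _ _ IM; apply: IM; exact: Ix.
Qed.

Lemma ideal_gen_ideal (S : set R) : is_ideal (ideal_gen S).
Proof. by apply: is_ideal_bigcap => I []. Qed.

Lemma ideal_gen_min (S I : set R) :
  is_ideal I -> S `<=` I -> ideal_gen S `<=` I.
Proof. exact: smallest_sub. Qed.

Lemma mem_ideal_gen (S : set R) : S `<=` ideal_gen S.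
Proof. exact: sub_gen_smallest. Qed.

Lemma jacobson_ideal : is_ideal (jacobson R).
Proof. by apply: is_ideal_bigcap => N []. Qed.

Lemma is_ideal_add_principal K C a : is_ideal K -> is_ideal C ->
  is_ideal [set k + c * a | k in K & c in C].
Proof.
move=> [K0 KD KM] [C0 CD CM]; split.
- by exists 0 => //; exists 0 => //; rewrite mul0r addr0.
- move=> _ _ [k Kk [c Cc <-]] [l Kl [d Cd <-]].
  exists (k + l); first exact: KD.
  by exists (c + d); [exact: CD|rewrite mulrDl addrACA].
- move=> r _ [k Kk [c Cc <-]]; exists (r * k); first exact: KM.
  by exists (r * c); [exact: CM|rewrite mulrDr mulrA].
Qed.

Lemma ideal_gen_lincomb (T : finType) (S : {set T}) (x : T -> R) y :
  ideal_gen (x @` [set` S]) y ->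
  exists c : T -> R, y = \sum_(i in S) c i * x i.
Proof.
move: y; apply: ideal_gen_min.
  split.
  - by exists (fun=> 0); rewrite big1 // => i _; rewrite mul0r.
  - move=> _ _ [c ->] [d ->]; exists (fun i => c i + d i).
    by rewrite -big_split; apply: eq_bigr => i _; rewrite mulrDl.
  - move=> r _ [c ->]; exists (fun i => r * c i).
    by rewrite mulr_sumr; apply: eq_bigr => i _; rewrite mulrA.
move=> _ [i /= Si <-]; exists (fun k => (k == i)%:R).
rewrite (bigD1 i) //= eqxx mul1r big1 ?addr0 // => k /andP[_ /negPf->].
by rewrite mul0r.
Qed.

Lemma ideal_gen_mem_sum (T : finType) (S : {set T}) (x : T -> R) (c : T -> R) :
  ideal_gen (x @` [set` S]) (\sum_(i in S) c i * x i).
Proof.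
apply: is_ideal_sum (ideal_gen_ideal _) _ => i Si.
case: (ideal_gen_ideal (x @` [set` S])) => _ _; apply.
by apply: mem_ideal_gen; exists i.
Qed.

Lemma generated_by_card (T : finType) (S : {set T}) (x : T -> R) :
  generated_by_n (ideal_gen (x @` [set` S])) #|S|.
Proof.
exists (map_tuple x (enum_tuple S)); congr ideal_gen.
apply/seteqP; split=> [_ [i /= Si <-]|y /= /mapP[i]].
  by apply: map_f; rewrite mem_enum.
by rewrite mem_enum => Si ->; exists i.
Qed.

Lemma generated_by_tnth (I : set R) n (s : n.-tuple R) :
  I = ideal_gen [set` s] -> I = ideal_gen (tnth s @` [set` [set: 'I_n]%SET]).
Proof.
move=> ->; congr ideal_gen; apply/seteqP; split=> [y /= /tnthP[i ->]|].
  by exists i => //=; rewrite inE.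
by move=> _ [i _ <-] /=; exact: mem_tnth.
Qed.

(** * Units and the Jacobson radical *)

(** Krull's theorem, by Zorn's lemma; it supplies every unit below, since
    maximal ideals detect non-units. *)
Lemma sub_maximal_ideal I : is_ideal I -> ~ I 1 ->
  exists2 N, maximal_ideal N & I `<=` N.
Proof.
move=> Iid I1.
(* Adjoining I inside the predicate makes the empty chain harmless. *)
pose P X := is_ideal (I `|` X) /\ ~ (I `|` X) 1.
have [F FP Ftot|X [[Xid X1] Xmax]] := @Zorn_bigcup R P.
  have bigl x : (I `|` \bigcup_(X in F) X) x ->
      I x \/ exists2 X, F X & (I `|` X) x.
    by case=> [Ix|[X FX Xx]]; [left|right; exists X => //; right].
  have bigr X x : F X -> (I `|` X) x -> (I `|` \bigcup_(X in F) X) x.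
    by move=> FX [Ix|Xx]; [left|right; exists X].
  case: (Iid) => I0 ID IM; split; last first.
    by move=> /bigl[/I1//|[X FX]]; apply: (FP _ FX).2.
  split; first by left.
  - move=> x y /bigl[Ix|[X FX Xx]] /bigl[Iy|[Y FY Yy]].
    + by left; apply: ID.
    + apply: (bigr Y) => //; case: (FP _ FY) => -[_ YD _] _.
      by apply: YD => //; left.
    + apply: (bigr X) => //; case: (FP _ FX) => -[_ XD _] _.
      by apply: XD => //; left.
    + have [XY|YX] := Ftot _ _ FX FY.
        apply: (bigr Y) => //; case: (FP _ FY) => -[_ YD _] _; apply: YD => //.
        by case: Xx => [|/XY]; [left|right].
      apply: (bigr X) => //; case: (FP _ FX) => -[_ XD _] _; apply: XD => //.
      by case: Yy => [|/YX]; [left|right].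
  - move=> r x /bigl[Ix|[X FX Xx]]; first by left; apply: IM.
    by apply: (bigr X) => //; case: (FP _ FX) => -[_ _ XM] _; apply: XM.
exists (I `|` X); last by move=> x; left.
split=> // [eT|L Lid sL nL]; first by apply: X1; rewrite eT.
apply/seteqP; split=> // x Lx; apply: contrapT => nx.
apply: (Xmax L).
  split; first by move=> y Xy; apply: sL; right.
  by move=> LX; apply: nx; right; apply: LX.
have eL : I `|` L = L by apply/setUidPr => y Iy; apply: sL; left.
by split; rewrite eL // => /(ideal_eqT Lid).
Qed.

Lemma nonunit_sub_maximal x : ~ (exists u, u * x = 1) ->
  exists2 N, maximal_ideal N & N x.
Proof.
move=> xnu.
have Xid : is_ideal [set u * x | u in [set: R]].
  split=> [|_ _ [u _ <-] [v _ <-]|r _ [u _ <-]].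
  - by exists 0; rewrite ?mul0r.
  - by exists (u + v); rewrite ?mulrDl.
  - by exists (r * u); rewrite ?mulrA.
have [[u _ ux]|N Nmax sN] := sub_maximal_ideal Xid; first by apply: xnu; exists u.
by exists N => //; apply: sN; exists 1; rewrite ?mul1r.
Qed.

Lemma jacobson_unit c : jacobson R c -> exists u, u * (1 - c) = 1.
Proof.
move=> Jc; apply: contrapT => /nonunit_sub_maximal[N Nmax Nc].
case: (Nmax) => Nid NT _; apply: NT; apply: ideal_eqT => //.
by rewrite -(subrK c 1); case: (Nid) => _ ND _; apply: ND => //; exact: Jc.
Qed.

Lemma local_unit N x : local_ring R -> maximal_ideal N -> ~ N x ->
  exists u, u * x = 1.
Proof.
move=> Rloc Nmax Nx; apply: contrapT => /nonunit_sub_maximal[L Lmax Lx].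
by apply: Nx; rewrite -(local_max_idealP Rloc Nmax) (local_max_idealP Rloc Lmax).
Qed.

(** An ideal whose complement consists of units contains every proper ideal. *)
Lemma nonunits_local N : is_ideal N -> ~ N 1 ->
  (forall x, ~ N x -> exists u, u * x = 1) -> maximal_ideal N /\ local_ring R.
Proof.
move=> Nid N1 Nunit.
have sub L : is_ideal L -> L <> setT -> L `<=` N.
  move=> Lid LT x Lx; apply: contrapT => /Nunit[u ux]; apply: LT.
  by apply: ideal_eqT => //; rewrite -ux; case: Lid => _ _; apply.
have NT : N <> setT by move=> eT; apply: N1; rewrite eT.
have Nmax : maximal_ideal N.
  by split=> // L Lid NL LT; apply/seteqP; split=> //; apply: sub.
by split=> //; exists N; split=> // L [Lid LT Lmax]; apply: Lmax => //; apply: sub.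
Qed.

(** Induction on a generating family of J, with K generalized: absorbing the
    first generator a into K gives J inside K + R a by induction.  Hence
    Jac J is inside K + Jac a, so a = k + c a with k in K and c in Jac, and
    a lies in K because 1 - c is a unit. *)
Lemma nakayama J K : is_ideal J -> fin_gen J -> is_ideal K ->
  J `<=` ideal_gen (K `|` [set c * b | c in jacobson R & b in J]) -> J `<=` K.
Proof.
move=> Jid [n [s Js]] + +.
have sJ : [set` tval s] `<=` J by rewrite Js; exact: mem_ideal_gen.
have {Js} : J `<=` ideal_gen (K `|` [set` tval s]).
  rewrite {1}Js; apply: ideal_gen_min (ideal_gen_ideal _) _ => x sx.
  by apply: mem_ideal_gen; right.
elim: (tval s) K sJ => [|a t IHt] K sJ Js Kid JK.
  by move=> x /Js; apply: ideal_gen_min => // y [].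
pose K' := [set k + c * a | k in K & c in [set: R]].
have K'id : is_ideal K' := is_ideal_add_principal a Kid is_idealT.
have KK' : K `<=` K' by move=> k Kk; exists k => //; exists 0; rewrite // mul0r addr0.
have JK' : J `<=` K'.
  apply: IHt => // [x tx|x /Js|x /JK].
  - by apply: sJ => /=; rewrite inE tx orbT.
  - apply: ideal_gen_min (ideal_gen_ideal _) _ x => x [/KK' K'x|].
      by apply: mem_ideal_gen; left.
    rewrite /= inE => /orP[/eqP->|tx]; apply: mem_ideal_gen; last by right.
    left; exists 0; first by case: Kid.
    by exists 1; rewrite // mul1r add0r.
  - apply: ideal_gen_min (ideal_gen_ideal _) _ x => x [/KK' K'x|IJx].
      by apply: mem_ideal_gen; left.
    by apply: mem_ideal_gen; right.
have [K0 KD KM] := Kid; have [jac0 _ jacM] := jacobson_ideal.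
have [k Kk [c jc ka]] : [set k + c * a | k in K & c in jacobson R] a.
  have /JK : J a by apply: sJ; rewrite /= inE eqxx.
  apply: ideal_gen_min; first exact: is_ideal_add_principal jacobson_ideal.
  move=> x [Kx|[c jc [b /JK'[k Kk [r _ <-]] <-]]].
    by exists x => //; exists 0; rewrite // mul0r addr0.
  exists (c * k); first exact: KM.
  by exists (r * c); [exact: jacM|rewrite mulrDr mulrA (mulrC c r)].
have [u u1c] := jacobson_unit jc.
have Ka : K a.
  rewrite -(mul1r a) -u1c -mulrA; apply: KM.
  by rewrite mulrBl mul1r -{1}ka addrK.
by move=> x /JK'[l Kl [r _ <-]]; apply: KD => //; apply: KM.
Qed.

(** A coefficient outside N would be a unit, and the relation would then express
    its generator through the others, against minimality. *)
Lemma minimal_generators_syzygy N (T : finType) (x : T -> R) (S : {set T})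
    (q : T -> R) :
  local_ring R -> maximal_ideal N ->
  (forall S' : {set T}, S' \subset S ->
     ideal_gen (x @` [set` S]) `<=` ideal_gen (x @` [set` S']) -> S' = S) ->
  \sum_(i in S) q i * x i = 0 -> forall k, k \in S -> N (q k).
Proof.
move=> Rloc Nmax Smin q0 k Sk; apply: contrapT => /(local_unit Rloc Nmax)[u uq].
suff Sk0 : S :\ k = S by move: Sk; rewrite -Sk0 !inE eqxx.
apply: Smin; first exact: subsetDl.
apply: ideal_gen_min (ideal_gen_ideal _) _ => _ [i /= Si <-].
have [->|ik] := eqVneq i k; last first.
  by apply: mem_ideal_gen; exists i => //=; rewrite !inE ik.
have -> : x k = - u * \sum_(i in S :\ k) q i * x i.
  move: q0; rewrite (big_setD1 k Sk) /= => /eqP; rewrite addr_eq0 => /eqP qk.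
  by rewrite mulNr -mulrN -qk mulrA uq mul1r.
case: (ideal_gen_ideal (x @` [set` S :\ k])) => _ _; apply.
exact: ideal_gen_mem_sum.
Qed.

End Ideals.

Lemma is_ideal_preimage (R S : comPzRingType) (g : {rmorphism R -> S})
    (I : set S) : is_ideal I -> is_ideal [set r | I (g r)].
Proof.
case=> I0 ID IM; split=> [|x y|r x] /=; rewrite ?(rmorph0, rmorphD, rmorphM) //.
- exact: ID.
- exact: IM.
Qed.

Lemma is_ideal_image (R S : comPzRingType) (g : {rmorphism R -> S})
    (I : set R) : (forall s, exists r, g r = s) -> is_ideal I ->
  is_ideal (g @` I).
Proof.
move=> gsurj [I0 ID IM]; split.
- by exists 0; rewrite ?rmorph0.
- by move=> _ _ [x Ix <-] [y Iy <-]; exists (x + y); rewrite ?rmorphD //; apply: ID.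
- move=> s _ [x Ix <-]; have [r <-] := gsurj s.
  by exists (r * x); rewrite ?rmorphM //; apply: IM.
Qed.

(** * The amalgamation *)

Section Amalgamation.
Variables (A B : comPzRingType) (f : {rmorphism A -> B}) (J : ideal B).
Local Notation R := (amalg f J).
Implicit Types (a : A) (b : B) (r : R).

Definition amalg_fst : {rmorphism R -> A} := fst \o \val.
Definition amalg_snd : {rmorphism R -> B} := snd \o \val.

Lemma amalg_inj r r' :
  amalg_fst r = amalg_fst r' -> amalg_snd r = amalg_snd r' -> r = r'.
Proof.
rewrite /amalg_fst /amalg_snd /= => e1 e2; apply: val_inj.
by rewrite (surjective_pairing (val r)) e1 e2 -surjective_pairing.
Qed.

Lemma amalg_sndB r : (J : set B) (amalg_snd r - f (amalg_fst r)).
Proof.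
have := valP r; rewrite in_setE => -[a _ [j Jj e]].
by rewrite /amalg_fst /amalg_snd /= -e addrAC subrr add0r.
Qed.

Lemma amalg_pair a b : (J : set B) (b - f a) ->
  exists r, amalg_fst r = a /\ amalg_snd r = b.
Proof.
move=> Jb; have ab : (a, b) \in amalg_set f J.
  by rewrite in_setE; exists a => //; exists (b - f a) => //; rewrite addrC subrK.
by exists (Sub (a, b) ab : R).
Qed.

Lemma amalg_fst_surj a : exists r, amalg_fst r = a.
Proof.
have [|r [<- _]] := @amalg_pair a (f a); last by exists r.
by rewrite subrr; case: (idealP J).
Qed.

Lemma amalg_snd_surj :
  [set f a + j | a in [set: A] & j in J] = [set: B] ->
  forall b, exists r, amalg_snd r = b.
Proof.
move=> hB b; have [a _ [j Jj <-]] : [set f a + j | a in [set: A] & j in J] b.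
  by rewrite hB.
have [|r [_ <-]] := @amalg_pair a (f a + j); last by exists r.
by rewrite addrAC subrr add0r.
Qed.

(** With u inverse to the first component, f u times the second component is
    1 - c with c in J, hence a unit.  The inverse pair (u, v f(u)) is again in
    the amalgamation because v f(u) - f(u) = v c f(u) is in J. *)
Lemma amalg_unit r : J `<=` jacobson B ->
  (exists u, u * amalg_fst r = 1) -> exists v, v * r = 1.
Proof.
move=> JJac [u ur]; have [_ _ JM] := idealP J.
have Jr := amalg_sndB r.
pose c := - (f u * (amalg_snd r - f (amalg_fst r))).
have fur : f u * amalg_snd r = 1 - c.
  by rewrite /c opprK mulrBr -rmorphM ur rmorph1 addrC subrK.
have Jc : (J : set B) c by apply: is_idealN (idealP J) _; apply: JM.
have [v vc] := jacobson_unit (JJac _ Jc).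
have [|w [w1 w2]] := @amalg_pair u (v * f u).
  have -> : v * f u - f u = (f u * v) * c; last exact: JM.
  by rewrite -{2}[f u]mul1r -vc -mulrBl mulrBr mulr1 opprB addrC subrK mulrAC (mulrC v).
exists w; apply: amalg_inj; rewrite rmorphM rmorph1 ?w1 ?w2 //.
by rewrite -mulrA fur.
Qed.

Lemma amalg_local (M : set A) : local_ring A -> maximal_ideal M ->
  J `<=` jacobson B ->
  maximal_ideal [set r | M (amalg_fst r)] /\ local_ring R.
Proof.
move=> Aloc Mmax JJac; have [Mid MT _] := Mmax.
apply: nonunits_local.
- exact: is_ideal_preimage.
- by rewrite /= => /(ideal_eqT Mid).
- by move=> r /(local_unit Aloc Mmax); exact: amalg_unit.
Qed.

(** Let K be spanned by the lifts of generators of M and the pairs (0, j) for j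
    among generators of J.  Images of ideals under the onto maps p and q are
    ideals, so p maps K onto M and q maps the kernel of p in K onto J; hence K
    contains every element of the maximal ideal. *)
Lemma amalg_max_generated (M : set A) m n :
  [set f a + j | a in [set: A] & j in J] = [set: B] -> is_ideal M ->
  generated_by_n M m -> generated_by_n J n ->
  generated_by_n [set r | M (amalg_fst r)] (m + n).
Proof.
move=> hB Mid [s Ms] [t Jt].
have [l lP] := choice amalg_fst_surj.
have /choice[e eP] b : exists r,
    (J : set B) b -> amalg_fst r = 0 /\ amalg_snd r = b.
  have [Jb|nJb] := pselect ((J : set B) b); last by exists 0.
  have [|r rP] := @amalg_pair 0 b; last by exists r.
  by rewrite rmorph0 subr0.
have tJ b : b \in t -> (J : set B) b
  by move=> tb; rewrite Jt; exact: mem_ideal_gen.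
exists [tuple of map_tuple l s ++ map_tuple e t].
set N := [set r | _]; set K := ideal_gen _.
have NE r : N r = M (amalg_fst r) by [].
have Kid : is_ideal K by exact: ideal_gen_ideal.
have Nid : is_ideal N by exact: is_ideal_preimage.
apply/seteqP; split; last first.
  apply: ideal_gen_min => // r /=; rewrite mem_cat => /orP[]/mapP[x xs ->].
    by rewrite NE lP Ms; exact: mem_ideal_gen.
  by rewrite NE (eP _ (tJ _ xs)).1; case: Mid.
have MK : M `<=` amalg_fst @` K.
  rewrite Ms; apply: ideal_gen_min; first exact: is_ideal_image amalg_fst_surj _.
  move=> x /= xs; exists (l x); last exact: lP.
  by apply: mem_ideal_gen; rewrite /= mem_cat map_f.
pose K0 := K `&` [set r | amalg_fst r = 0].
have K0id : is_ideal K0.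
  case: Kid => K_0 KD KM; split=> [|x y [Kx x0] [Ky y0]|r x [Kx x0]];
    split=> //; rewrite /mkset.
  - exact: KD.
  - by rewrite rmorphD x0 y0 addr0.
  - exact: KM.
  - by rewrite rmorphM x0 mulr0.
have JK : J `<=` amalg_snd @` K0.
  rewrite {1}Jt; apply: ideal_gen_min.
    exact: is_ideal_image (amalg_snd_surj hB) _.
  move=> x /= xt; have [e0 ex] := eP _ (tJ _ xt).
  exists (e x) => //; split=> //; apply: mem_ideal_gen.
  by rewrite /= mem_cat [X in _ || X]map_f ?orbT.
move=> r /MK[k Kk kr].
have /JK[k' [Kk' k'0] k'r] : (J : set B) (amalg_snd (r - k)).
  have := amalg_sndB (r - k).
  by rewrite [amalg_fst _]rmorphB kr subrr rmorph0 subr0.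
rewrite -(subrK k r); case: (Kid) => _ KD _; apply: (KD) => //.
suff -> : r - k = k' by [].
by apply: amalg_inj => //; rewrite k'0 rmorphB kr subrr.
Qed.

(** Splits n generators of the maximal ideal into a minimal set of generators
    of M modulo 0 x J and a complement that, once corrected to lie in 0 x J,
    generates J by Nakayama's lemma. *)
Lemma amalg_generators_lower_bound (M : set A) n :
  local_ring A -> maximal_ideal M -> fin_gen M -> fin_gen J ->
  ideal_gen [set f a | a in M] `<=` jacobson B -> J `<=` jacobson B ->
  generated_by_n [set r | M (amalg_fst r)] n -> (nu M + nu J <= n)%N.
Proof.
move=> Aloc Mmax Mfg Jfg MJac JJac [s /generated_by_tnth].
set N := [set r | _]; set z := tnth s => Nz.
have NE r : N r = M (amalg_fst r) by [].
have [Mid _ _] := Mmax; have [J0 JD JM] := idealP J.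
have [l lP] := choice amalg_fst_surj.
pose x i := amalg_fst (z i).
have zN i : N (z i) by rewrite Nz; apply: mem_ideal_gen; exists i => //=; rewrite inE.
have gx : M `<=` ideal_gen (x @` [set` [set: 'I_n]%SET]).
  move=> a Ma; have : N (l a) by rewrite NE lP.
  rewrite Nz => /ideal_gen_lincomb[c e].
  rewrite -(lP a) e rmorph_sum; under eq_bigr do rewrite rmorphM.
  exact: ideal_gen_mem_sum.
pose P (S : {set 'I_n}) := `[< M `<=` ideal_gen (x @` [set` S]) >].
have [S /minsetP[/asboolP MS Smin]] : {S | minset P S}.
  by apply: ex_minset; exists [set: 'I_n]%SET; apply/asboolP.
have MSe : M = ideal_gen (x @` [set` S]).
  apply/seteqP; split=> //; apply: ideal_gen_min => // _ [i _ <-].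
  exact: zN.
have nuM : (nu M <= #|S|)%N.
  apply: (nuP Mfg).2; rewrite [X in generated_by_n X]MSe.
  exact: generated_by_card.
have /choice[d dP] i : exists d : 'I_n -> A, x i = \sum_(k in S) d k * x k.
  by apply: ideal_gen_lincomb; rewrite -MSe; exact: zN.
pose z' i := z i - \sum_(k in S) l (d i k) * z k.
have z'0 i : amalg_fst (z' i) = 0.
  rewrite rmorphB rmorph_sum; apply/eqP; rewrite subr_eq0; apply/eqP.
  by rewrite [LHS]dP; apply: eq_bigr => k _; rewrite rmorphM lP.
pose w i := amalg_snd (z' i).
have wJ i : (J : set B) (w i).
  by have := amalg_sndB (z' i); rewrite z'0 rmorph0 subr0.
suff Jw : (J : set B) = ideal_gen (w @` [set` (~: S)%SET]).
  have nuJ : (nu J <= #|(~: S)%SET|)%N.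
    apply: (nuP Jfg).2; rewrite [X in generated_by_n X]Jw.
    exact: generated_by_card.
  by rewrite -[leqRHS]card_ord -(cardsC S) leq_add.
apply/seteqP; split; last first.
  by apply: ideal_gen_min (idealP J) _ => _ [i _ <-].
set K := ideal_gen _; have Kid : is_ideal K by exact: ideal_gen_ideal.
apply: nakayama (idealP J) Jfg Kid _ => j Jj.
set L := ideal_gen _; have Lid : is_ideal L by exact: ideal_gen_ideal.
have LD : forall b b', L b -> L b' -> L (b + b') by case: Lid.
have KL : K `<=` L by move=> b Kb; apply: mem_ideal_gen; left.
have jacL b b' : jacobson B b -> (J : set B) b' -> L (b * b').
  by move=> jb Jb'; apply: mem_ideal_gen; right; exists b => //; exists b'.
have [|rj [rj1 rj2]] := @amalg_pair 0 j; first by rewrite rmorph0 subr0.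
have : N rj by rewrite NE rj1; case: Mid.
rewrite Nz => /ideal_gen_lincomb[r rE].
(* Coefficients of rj once each z_i with i outside S is replaced by
   z' i + \sum_(k in S) l (d i k) * z k. *)
pose q k := r k + \sum_(i in (~: S)%SET) r i * l (d i k).
have {}rE : rj = \sum_(k in S) q k * z k + \sum_(i in (~: S)%SET) r i * z' i.
  rewrite rE (bigID (mem S)) /=.
  under eq_bigl do rewrite inE.
  under [X in _ + X = _]eq_bigl do rewrite inE.
  under [X in _ = X + _]eq_bigr do rewrite mulrDl.
  rewrite big_split -addrA; congr (_ + _).
  under [X in _ = X + _]eq_bigr do rewrite mulr_suml.
  rewrite exchange_big -big_split /=.
  apply: eq_big => i; first by rewrite inE.
  move=> _; rewrite /z' mulrBr mulr_sumr.
  under [X in _ - X]eq_bigr do rewrite mulrA.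
  by rewrite addrC subrK.
have q0 : \sum_(k in S) amalg_fst (q k) * x k = 0.
  transitivity (amalg_fst rj) => //.
  rewrite rE rmorphD !rmorph_sum [X in _ = _ + X]big1 ?addr0.
    by apply: eq_bigr => k _; rewrite rmorphM.
  by move=> i _; rewrite rmorphM z'0 mulr0.
have Mq : forall k, k \in S -> M (amalg_fst (q k)).
  apply: minimal_generators_syzygy Aloc Mmax _ q0 => S' S'S; rewrite -MSe => MS'.
  by apply: Smin => //; apply/asboolP.
rewrite -rj2 rE rmorphD; apply: (LD); last first.
  apply: KL; rewrite rmorph_sum; under eq_bigr do rewrite rmorphM.
  exact: ideal_gen_mem_sum.
have fM a : M a -> jacobson B (f a).
  by move=> Ma; apply: MJac; apply: mem_ideal_gen; exists a.
have sndjac r' : N r' -> jacobson B (amalg_snd r').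
  move=> Nr; rewrite -(subrK (f (amalg_fst r')) (amalg_snd r')).
  case: (jacobson_ideal B) => _ jD _; apply: jD; last exact: fM.
  exact: JJac (amalg_sndB _).
(* Each product q_k z_k has second component f(q_k x_k) up to terms of Jac(B) J,
   and the f(q_k x_k) sum to f(0) = 0. *)
have -> : amalg_snd (\sum_(k in S) q k * z k) =
    \sum_(k in S) (amalg_snd (q k) * (amalg_snd (z k) - f (x k)) +
                   f (x k) * (amalg_snd (q k) - f (amalg_fst (q k)))).
  apply/eqP; rewrite -subr_eq0 rmorph_sum -sumrB.
  apply/eqP; transitivity (f (\sum_(k in S) amalg_fst (q k) * x k)); last first.
    by rewrite q0 rmorph0.
  rewrite rmorph_sum; apply: eq_bigr => k _.
  rewrite !rmorphM !mulrBr (mulrC (f (x k))) (mulrC (f (x k))).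
  by rewrite addrA subrK opprB addrC subrK.
apply: is_ideal_sum => // k Sk; apply: LD; apply: jacL.
- exact: sndjac (Mq k Sk).
- exact: amalg_sndB.
- exact: fM (zN k).
- exact: amalg_sndB.
Qed.

End Amalgamation.

Theorem theorem4p4 (A B : comPzRingType) (f : {rmorphism A -> B})
    (J : ideal B) (M : set A)
    (hB : [set f a + j | a in [set: A] & j in J] = [set: B])
    (hA : local_ring A) (hM : maximal_ideal M)
    (hMfg : fin_gen M) (hJfg : fin_gen J)
    (hMJac : ideal_gen [set f a | a in M] `<=` jacobson B)
    (hJJac : J `<=` jacobson B) :
  [/\ local_ring (amalg f J),
      fin_gen (max_ideal (amalg f J))
    & embdim (amalg f J) = (embdim A + nu J)%N].
Proof.
have [Nmax Rloc] := amalg_local f hA hM hJJac.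
have [Mid _ _] := hM.
have Ngen := amalg_max_generated hB Mid (nuP hMfg).1 (nuP hJfg).1.
have Nfg : fin_gen [set r | M (amalg_fst f J r)].
  by exists (nu M + nu J)%N.
rewrite /embdim (local_max_idealP Rloc Nmax) (local_max_idealP hA hM).
split=> //; apply/eqP; rewrite eqn_leq (nuP Nfg).2 //=.
exact: amalg_generators_lower_bound (nuP Nfg).1.
Qed.
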